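(* For every integer $r \geq 2$ and every $\varepsilon > 0$ there is $\beta = \beta(r,\varepsilon) > 0$ such that every connected $n$-vertex $\beta$-graph $G$ satisfies the following: in any $r$-colouring of $E(G)$ there is a spanning tree of $G$ with at least $(\varphi(r) - \varepsilon) \cdot n$ edges of the same colour.
   Context: For $\beta>0$, a graph $G=(V,E)$ is a $\beta$-graph if $|V|\ge 1/\beta$ and there is an edge of $G$ between every pair of disjoint sets $U,W\subseteq V$ with $|U|,|W|\ge\beta|V|$. For integers $r,n$, $\varphi(r,n)$ is the smallest integer $k$ for which there are $k$-element sets $A_1,\dots,A_r\in\binom{[n]}{k}$ such that every pair $e\in\binom{[n]}{2}$ is contained in $A_i$ for some $i\in[r]$. Define $\varphi(r):=\lim_{n\to\infty}\varphi(r,n)/n$. It is known (Mills; Horák and Sauer) that this limit exists and equals $\min_n \varphi(r,n)/n$; in particular $\varphi(r,n)\ge\varphi(r)\cdot n$ for every $n$. *)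

(* Defs.v *)
From HB Require Import structures.
From mathcomp Require Import all_boot all_order all_algebra.
From mathcomp Require Import all_classical all_reals all_analysis.

Set Implicit Arguments.
Unset Strict Implicit.
Unset Printing Implicit Defensive.

Import Order.TTheory GRing.Theory Num.Theory.
Import numFieldNormedType.Exports.

Local Open Scope ring_scope.

(* Finite simple graphs with vertex set V. *)
Record sgraph (V : finType) := SGraph {
  adj :> rel V;
  adj_sym : symmetric adj;
  adj_irr : irreflexive adj }.

Section Graphs.
Variable V : finType.
Implicit Types G T : sgraph V.

Definition edges G : {set {set V}} :=
  [set e : {set V} | [exists x, exists y, G x y && (e == [set x; y])]]%SET.

Definition connected_graph G : Prop :=
  (0 < #|V|)%N /\ forall x y : V, connect G x y.

(* [ucycle] on a list of length at least 3 is a graph cycle; lists of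
   length 2 are excluded because they only traverse one edge back and forth. *)
Definition acyclic_graph G : Prop :=
  forall s : seq V, (2 < size s)%N -> ~ ucycle G s.

Definition tree_graph T : Prop := connected_graph T /\ acyclic_graph T.

(* T has the same vertex set V as G, hence is spanning. *)
Definition spanning_tree G T : Prop := subrel T G /\ tree_graph T.

Definition beta_graph (R : realType) (beta : R) G : Prop :=
  beta^-1 <= #|V|%:R /\
  forall U W : {set V}, [disjoint U & W] ->
    beta * #|V|%:R <= #|U|%:R -> beta * #|V|%:R <= #|W|%:R ->
    exists u w : V, [/\ u \in U, w \in W & G u w].

End Graphs.

Definition pair_cover (r n k : nat) : bool :=
  [exists A : {ffun 'I_r -> {set 'I_n}},
    [forall i, #|A i| == k] &&
    [forall e : {set 'I_n}, (#|e| == 2)%N ==> [exists i, e \subset A i]]].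

(* A k-subset of an n-set has k <= n, so the minimum may be taken over
   'I_n.+1; for r > 0 the value k = n is always admissible (all A i full). *)
Definition phi (r n : nat) : nat :=
  [arg min_(k < (ord_max : 'I_n.+1) | pair_cover r n k) (k : nat)]%N.

Definition phi_lim (R : realType) (r : nat) : R :=
  limn (fun n : nat => (phi r n)%:R / n%:R : R).

(* Main.v *)
Require Import Defs.
From HB Require Import structures.
From mathcomp Require Import all_boot all_order all_algebra.
From mathcomp Require Import all_classical all_reals all_analysis.
From mathcomp Require Import zify lra.

Set Implicit Arguments.
Unset Strict Implicit.
Unset Printing Implicit Defensive.

Import Order.TTheory GRing.Theory Num.Theory.
Import numFieldNormedType.Exports.

(** For a large constant [K], let the type of a vertex be the set of colours in
    which its monochromatic component has more than [K] vertices.  If two types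
    attained by linearly many vertices were disjoint, all edges between the two
    classes would lie in components of size at most [K], so the bipartite graph
    between the classes would have bounded degree, which a beta-graph forbids.
    Hence popular types pairwise intersect, and the sets [A_i] of vertices in
    big components of colour [i] cover all pairs of the set [V'] of vertices of
    popular type.  As [V'] misses few vertices, some [A_i] has at least about
    [phi * n] vertices.  A maximal forest in colour [i] omits only one vertex
    per big component, that is at most [n / K] vertices of [A_i]; extend it to
    a spanning tree. *)

(** * Forests: extension within a graph and edge counts *)

Section Forests.
Variable V : finType.
Implicit Types F G H T : sgraph V.

Lemma sgraph_connect_sym G : connect_sym G.
Proof. exact/sym_connect_sym/adj_sym. Qed.

Definition empty_graph : sgraph V :=
  @SGraph V (fun _ _ => false) (fun _ _ => erefl) (fun _ => erefl).

Lemma empty_graph_acyclic : acyclic_graph empty_graph.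
Proof. by case=> [|x [|y s]] //= _ /andP[]. Qed.

Section AddEdge.
Variables (F : sgraph V) (x y : V) (xy : x != y).

Definition add_edge_rel (a b : V) :=
  [|| F a b, (a == x) && (b == y) | (a == y) && (b == x)].

Lemma add_edge_sym : symmetric add_edge_rel.
Proof.
by move=> a b; rewrite /add_edge_rel adj_sym orbA orbAC -orbA
  [(b == x) && _]andbC [(b == y) && _]andbC.
Qed.

Lemma add_edge_irr : irreflexive add_edge_rel.
Proof.
move=> a; rewrite /add_edge_rel adj_irr /=; case: (eqVneq a x) => [->|] //=.
  by rewrite (negbTE xy).
by rewrite andbF.
Qed.

Definition add_edge := SGraph add_edge_sym add_edge_irr.

Lemma add_edge_sub : subrel F add_edge.
Proof. by move=> a b /= ab; rewrite /add_edge_rel ab. Qed.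

(** Every traversal of the new edge visits both its ends, hence [a]. *)
Lemma path_add_edge_avoid (a b : V) s : a \in [set x; y]%SET ->
  a \notin b :: s -> path add_edge b s -> path F b s.
Proof.
move=> axy; elim: s b => //= d s IH b.
rewrite !inE !negb_or => /and3P[ab ad as_] /andP[bd ds].
rewrite (IH d) ?inE ?negb_or ?ad ?as_ ?ds // andbT.
case/or3P: bd => // /andP[/eqP bE /eqP dE]; subst b d; move: axy ab ad; rewrite !inE;
by case/orP=> /eqP->; rewrite eqxx.
Qed.

(** A cycle through the new edge, with that edge removed, is an [F]-path between [x] and [y]. *)
Lemma add_edge_acyclic : acyclic_graph F -> ~~ connect F x y ->
  acyclic_graph add_edge.
Proof.
move=> acF ncxy s s2 /andP[cs us].
have [cF|ncF] := boolP (cycle F s); first by apply: (acF s s2); apply/andP.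
(* A cycle that is not a cycle of [F] traverses the new edge; rotate it to begin there. *)
have [a [b [t [n [sE ab]]]]] : exists a b t n,
    rot n s = [:: a, b & t] /\ [set a; b]%SET = [set x; y]%SET.
  have [a sa nab] : exists2 a, a \in s & ~~ F a (next s a).
    apply/hasP; apply: contraR ncF; rewrite -all_predC => /allP al.
    apply: (sub_in_cycle (P := mem s) _ _ (cycle_next us)); last exact/allP.
    by move=> a b sa _ /= /eqP <-; have /= := al a sa; rewrite negbK.
  have := next_cycle cs sa; rewrite /= /add_edge_rel (negbTE nab) /= => abE.
  have [n t sE] := rot_to sa.
  case: t sE => [|b t] sE.
    by move: (size_rot n s); rewrite sE => /= sz; rewrite -sz in s2.
  exists a, b, t, n; split=> //.
  have := next_rot n us a; rewrite sE /= eqxx => bE.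
  by rewrite -bE in abE; case/orP: abE => /andP[/eqP-> /eqP->] //; rewrite finset.setUC.
move: us cs s2; rewrite -(rot_uniq n) -(rot_cycle n) -(size_rot n) sE => us cs s2.
have t0 : (0 < size t)%N by move: s2 => /=; case: (t).
move: cs; rewrite /= rcons_path => /and3P[hab hbt hta].
have pt : path F b t.
  apply: (@path_add_edge_avoid a) => //; last by case/andP: us.
  by rewrite -ab set21.
(* If the closing edge were the new one, then [last b t = b], but [t] is nonempty and no vertex
   repeats. *)
have lta : F (last b t) a.
  move: hta; rewrite /= /add_edge_rel => /orP[//|h].
  have lb : last b t = b.
    have : [set last b t; a]%SET = [set x; y]%SET.
      by case/orP: h => /andP[/eqP-> /eqP->] //; rewrite finset.setUC.
    rewrite -ab => /setP/(_ (last b t)); rewrite !inE eqxx /= => /esym/orP[/eqP la|/eqP//].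
    by move: us => /= /andP[]; rewrite -la mem_last.
  move: us lb => /= /and3P[_ bt _] lb; case: (t) t0 bt lb => //= d u _ bdu lb.
  by move: bdu; rewrite -{1}lb mem_last.
have cba : connect F b a.
  apply: (connect_trans (y := last b t)); last exact: connect1.
  by apply/connectP; exists t.
have /setP h := ab.
move: (h x) (h y) (h a) (h b); rewrite !inE !eqxx /= orbT.
move=> hx hy _ _; case/negP: ncxy.
case/orP: hx => /eqP-> ; case/orP: hy => /eqP-> //;
  by rewrite ?connect0 // sgraph_connect_sym.
Qed.

End AddEdge.

(** As long as an edge of [H] joins two components of the forest, it can be added; each addition
    lowers the number of non-adjacent pairs. An arbitrary initial [F] lets a monochromatic forest
    grow into a spanning tree. *)
Lemma acyclic_extend F H : acyclic_graph F -> subrel F H ->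
  exists T, [/\ acyclic_graph T, subrel F T, subrel T H &
    forall x y, connect H x y -> connect T x y].
Proof.
move: {2}_.+1 (ltnSn #|[set p : V * V | ~~ F p.1 p.2]%SET|) => m.
elim: m F => // m IH F hm acF sFH.
have [/existsP[x /existsP[y /andP[Hxy nc]]]|ex] :=
    boolP [exists x, exists y, H x y && ~~ connect F x y].
  have xy : x != y by apply: contraNneq nc => ->; exact: connect0.
  have sF := @add_edge_sub F x y xy.
  have [] := IH (add_edge F xy).
  - rewrite -ltnS; apply: leq_trans hm; rewrite ltnS; apply: proper_card.
    apply/properP; split.
      by apply/fintype.subsetP=> -[a b]; rewrite !inE /=; apply: contra => /sF.
    exists (x, y); rewrite !inE /= /add_edge_rel ?eqxx ?orbT //.
    by apply: contra nc => /connect1.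
  - exact: add_edge_acyclic.
  - move=> a b /or3P[/sFH //| |] /andP[/eqP-> /eqP->] //.
    by rewrite adj_sym.
  move=> T [aT sT sTH cT]; exists T; split=> // a b /sF; exact: sT.
exists F; split=> // x y; apply: connect_sub => {}x {}y Hxy.
apply: contraNT ex => nc; apply/existsP; exists x; apply/existsP; exists y.
by rewrite Hxy.
Qed.

(* Each vertex other than the root of its component is charged the first edge
   of a shortest path to that root. *)
Lemma card_nonroots_le_edges F :
  (#|[set v | fingraph.root F v != v]%SET| <= #|edges F|)%N.
Proof.
have symF := sgraph_connect_sym F.
have exd v : exists n, [exists s : n.-tuple V, path F v s && (last v s == fingraph.root F v)].
  have /connectP[s ps ls] := connect_root F v.
  by exists (size s); apply/existsP; exists (in_tuple s); rewrite /= ps ls eqxx.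
pose d v := ex_minn (exd v).
have exp v : exists w, fingraph.root F v != v -> F v w /\ (d w < d v)%N.
  have [rv|rv] := eqVneq (fingraph.root F v) v; first by exists v.
  rewrite /d; case: ex_minnP => n /existsP[s /andP[ps /eqP ls]] _.
  case: n s ps ls => [|n] s; first by rewrite tuple0 /= => _ lv; rewrite -lv eqxx in rv.
  case: s => -[|w s] //= sz /andP[vw ps] ls; exists w => _; split=> //.
  case: ex_minnP => k _ hk; apply: hk; apply/existsP; exists (Tuple (sz : size s == n)).
  by rewrite /= ps ls; apply/eqP/(fingraph.rootP symF)/connect1.
have [p hp] := choice exp.
(* Distinct vertices charged to the same edge would each have smaller [d] than the other. *)
have inj : {in [set v | fingraph.root F v != v]%SET &, injective (fun v => [set v; p v]%SET)}.
  move=> v w; rewrite !inE => /hp[_ dv] /hp[_ dw] /setP E.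
  apply/eqP; apply/idPn => vw.
  move: (E v) (E w); rewrite !inE !eqxx /= (eq_sym w v) (negbTE vw) /=.
  move=> /esym/eqP vE /eqP wE; move: dv dw; rewrite -wE -vE => h1 h2.
  by have := ltn_trans h1 h2; rewrite ltnn.
rewrite -(card_in_imset inj); apply: subset_leq_card; apply/fintype.subsetP=> e /imsetP[v].
rewrite inE => /hp[vp _] ->; rewrite inE; apply/existsP; exists v; apply/existsP.
by exists (p v); rewrite vp eqxx.
Qed.

(** Non-roots are paid for by edges. Each big root has at least [K] vertices in its component, and
    components are disjoint, so [K] times the number of big roots is at most [#|V|]. *)
Lemma card_big_components F K :
  (K * #|[set v | K < #|[set w | connect F v w]%SET|]%SET|
     <= K * #|edges F| + #|V|)%N.
Proof.
have symF := sgraph_connect_sym F.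
set B := [set v | _]%SET; pose N := [set v | fingraph.root F v != v]%SET.
rewrite -(cardsID N B) mulnDr leq_add //.
  rewrite leq_mul2l; apply/orP; right.
  apply: leq_trans (card_nonroots_le_edges F); exact/subset_leq_card/finset.subsetIr.
rewrite -sum1_card -sum1_card big_distrr /=.
rewrite [leqRHS](bigID (fun v => fingraph.root F v \in B :\: N)) /=; apply: leq_trans (leq_addr _ _).
rewrite [leqRHS](partition_big (fingraph.root F) (mem (B :\: N)%SET)) //=; apply: leq_sum => v vBN.
rewrite muln1 sum1_card.
move: (vBN); rewrite !inE negbK => /andP[/eqP rv Kv].
apply: leq_trans (ltnW Kv) _; apply/subset_leq_card/fintype.subsetP => w; rewrite !inE.
move/(fingraph.rootP symF) => vw; rewrite unfold_in /=.
by rewrite -vw rv eqxx andbT inE /N !inE rv eqxx Kv.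
Qed.

End Forests.

(** * Coverings of pairs by sets of equal size *)

Section PairCover.
Variable r : nat.
Hypothesis r_gt0 : (0 < r)%N.

Lemma subset_of_card (T : finType) (B : {set T}) k : (#|B| <= k <= #|T|)%N ->
  exists2 C : {set T}, B \subset C & #|C| = k.
Proof.
move=> /andP[]; move: {2}_.+1 (ltnSn (k - #|B|)) => m; elim: m B => // m IH B hm Bk kT.
have [E|ne] := eqVneq #|B| k; first by exists B.
have Bk' : (#|B| < k)%N by rewrite ltn_neqAle ne.
have [x xB] : exists x, x \notin B.
  apply/existsP; rewrite -negb_forall; apply/negP=> /forallP al.
  have := leq_trans Bk' kT; rewrite ltnNge => /negP; apply.
  by apply/subset_leq_card/fintype.subsetP => x _; exact: al.
have cB : #|x |: B| = #|B|.+1 by rewrite cardsU1 xB.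
have [||//|C sC cC] := IH (x |: B)%SET; rewrite ?cB //.
  by rewrite subnS prednK ?subn_gt0 // -ltnS.
by exists C => //; apply: fintype.subset_trans sC; exact: finset.subsetUr.
Qed.

Lemma pair_cover_full n : pair_cover r n (ord_max : 'I_n.+1).
Proof.
apply/existsP; exists [ffun _ => [set: 'I_n]%SET]; apply/andP; split.
  by apply/forallP=> i; rewrite ffunE cardsT card_ord.
apply/forallP=> e; apply/implyP=> _; apply/existsP; exists (Ordinal r_gt0).
by rewrite ffunE finset.subsetT.
Qed.

Lemma phi_le_size n : (phi r n <= n)%N.
Proof. by rewrite /phi; case: arg_minnP; rewrite ?pair_cover_full // => k _ _; rewrite -ltnS. Qed.

Lemma phi_cover n : exists A : 'I_r -> {set 'I_n},
  (forall i, #|A i| = phi r n) /\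
  forall x y, x != y -> exists i, x \in A i /\ y \in A i.
Proof.
rewrite /phi; case: arg_minnP; rewrite ?pair_cover_full // => k.
move=> /existsP[A /andP[/forallP cA /forallP hA]] _; exists A; split=> [i|x y xy].
  exact/eqP/cA.
have /implyP := hA [set x; y]%SET; rewrite cards2 xy => /(_ isT)/existsP[i /fintype.subsetP s].
by exists i; rewrite !s ?set21 ?set22.
Qed.

(** The preimages under [f] are padded to exactly [k] elements, as [pair_cover] demands. *)
Lemma phi_le (V : finType) n k (f : 'I_n -> V) (A : 'I_r -> {set V}) :
  injective f -> (forall i, #|A i| <= k)%N ->
  (forall x y, x != y -> exists i, f x \in A i /\ f y \in A i) ->
  (phi r n <= k)%N.
Proof.
move=> injf cA hA; have [nk|kn] := leqP n k; first exact: leq_trans (phi_le_size n) nk.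
pose B i := (f @^-1: A i)%SET.
have /choice[C hC] : forall i, exists C : {set 'I_n}, B i \subset C /\ #|C| = k.
  move=> i; have [|C] := @subset_of_card _ (B i) k; last by exists C.
  rewrite card_ord (ltnW kn) andbT; apply: leq_trans (cA i).
  rewrite -(card_imset _ injf); apply/subset_leq_card/fintype.subsetP => v /imsetP[x + ->].
  by rewrite inE.
rewrite /phi; case: arg_minnP; rewrite ?pair_cover_full // => j _ hj.
have kn' : (k < n.+1)%N := ltnW kn.
apply: (hj (Ordinal kn')); apply/existsP; exists [ffun i => C i]; apply/andP; split.
  by apply/forallP=> i; rewrite ffunE; apply/eqP; have [] := hC i.
apply/forallP=> e; apply/implyP=> /cards2P[x [y [xy ->]]].
have [i [xi yi]] := hA x y xy; apply/existsP; exists i; rewrite ffunE.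
have [/fintype.subsetP s _] := hC i; apply/fintype.subsetP=> z /set2P[]->; apply: s; by rewrite inE.
Qed.

(* [1 < n] is needed: [phi r 1 = 0], as there is no pair to cover. *)
Lemma phi_blowup n N : (1 < n)%N -> (phi r N <= (N %/ n).+1 * phi r n)%N.
Proof.
move=> n1; have n0 : (0 < n)%N by exact: ltnW.
have [A [cA hA]] := phi_cover n.
have dl (x : 'I_N) : (x %/ n < (N %/ n).+1)%N by rewrite ltnS leq_div2r // ltnW.
(* The residue is a point of the covered [n]-set, the quotient the index of its copy. *)
pose f (x : 'I_N) : 'I_n * 'I_(N %/ n).+1 :=
  (Ordinal (ltn_pmod x n0), Ordinal (dl x)).
apply: (@phi_le _ _ _ f (fun i => finset.setX (A i) [set: _]%SET)).
- move=> x y [xy1 xy2]; apply: val_inj.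
  by rewrite /= (divn_eq x n) (divn_eq y n) xy1 xy2.
- by move=> i; rewrite cardsX cardsT card_ord cA mulnC.
move=> x y _.
(* Copies of one point lie together in any set that covers this point and some other point [z]. *)
have [xy|xy] := eqVneq (f x).1 (f y).1.
  have [z zx] : exists z, (f x).1 != z.
    have [->|] := eqVneq (f x).1 (Ordinal n0); first by exists (Ordinal n1).
    by exists (Ordinal n0).
  have [i [xi zi]] := hA _ _ zx; exists i; rewrite !finset.in_setX !inE !andbT.
  by split; [|rewrite xy in xi]; exact: xi.
have [i [xi yi]] := hA _ _ xy; exists i; rewrite !finset.in_setX !inE !andbT; split=> //.
Qed.

End PairCover.

(** * Colour types of vertices and popular types *)

Lemma card_bigcup_le (I T : finType) (P : pred I) (F : I -> {set T}) :
  (#|\bigcup_(i | P i) F i| <= \sum_(i | P i) #|F i|)%N.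
Proof.
elim/big_rec2: _ => [|i n A _ An]; first by rewrite cards0.
by apply: leq_trans (leq_card_setU _ _) _; rewrite leq_add2l.
Qed.

Section ComponentTypes.
Variables (V : finType) (G : sgraph V) (r : nat) (c : {set V} -> 'I_r) (K b : nat).

Definition color_rel i (x y : V) := G x y && (c [set x; y]%SET == i).

Lemma color_rel_sym i : symmetric (color_rel i).
Proof. by move=> x y; rewrite /color_rel adj_sym finset.setUC. Qed.

Lemma color_rel_irr i : irreflexive (color_rel i).
Proof. by move=> x; rewrite /color_rel adj_irr. Qed.

Definition color_graph i := SGraph (color_rel_sym i) (color_rel_irr i).

Definition color_comp i v := [set w | connect (color_graph i) v w]%SET.

(** This is the type of [v]. *)
Definition big_colors v := [set i | (K < #|color_comp i v|)%N]%SET.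

Lemma color_comp_eq i v w : G v w -> c [set v; w]%SET = i ->
  color_comp i v = color_comp i w.
Proof.
move=> vw ci; apply/setP=> z; rewrite !inE.
apply: (same_connect (sgraph_connect_sym _)); apply: connect1.
by rewrite /= /color_rel vw ci eqxx.
Qed.

Hypothesis edge_between : forall U W : {set V}, [disjoint U & W] ->
  (b <= #|U|)%N -> (b <= #|W|)%N -> exists u w, [/\ u \in U, w \in W & G u w].

Definition popularity v := #|[set w | big_colors w == big_colors v]%SET|.

(** A popular class must still have [b] vertices after the loss of a set [U] of size [b] and of at
    most [r * K * b] vertices in small components meeting [U]. *)
Definition threshold := ((r * K + 2) * b)%N.

Definition popular := [set v | (threshold <= popularity v)%N]%SET.

(* If the two types were disjoint, every edge between the two classes would
   lie in a colour component of size at most K, so that [b] vertices of one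
   class would have at most [r * K * b] neighbours in the other. *)
Lemma popular_meet x y : x \in popular -> y \in popular ->
  exists i, i \in big_colors x /\ i \in big_colors y.
Proof.
rewrite !inE => px py; apply: contrapT => nex.
have disj i : i \in big_colors x -> i \notin big_colors y.
  by move=> ix; apply/negP => iy; apply: nex; exists i.
have /card_geqP[s [us ss sx]] : (b <= popularity x)%N.
  by apply: leq_trans px; rewrite /threshold addn2 mulSn leq_addr.
pose U := [set z in s]%SET; pose small u := [pred i | i \notin big_colors u].
pose N := (\bigcup_(u in U) \bigcup_(i | small u i) color_comp i u)%SET.
pose W := ([set w | big_colors w == big_colors y] :\: (U :|: N))%SET.
have cU : #|U| = b by rewrite cardsE -ss; exact/card_uniqP.
have cN : (#|N| <= r * K * b)%N.
  apply: leq_trans (card_bigcup_le _ _) _; rewrite mulnC -cU -sum_nat_const.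
  apply: leq_sum => u _; apply: leq_trans (card_bigcup_le _ _) _.
  apply: (@leq_trans (\sum_(i | small u i) K)).
    by apply: leq_sum => i; rewrite /small inE /= inE -leqNgt.
  by rewrite sum_nat_const leq_mul2r -[leqRHS]card_ord max_card orbT.
have cUN : (#|U :|: N| <= b + r * K * b)%N.
  by apply: leq_trans (leq_card_setU _ _) _; rewrite cU leq_add2l.
have cW : (b <= #|W|)%N.
  rewrite /W cardsD; apply: leq_trans (leq_sub2l _ (subset_leq_card (finset.subsetIr _ _))).
  apply: leq_trans (leq_sub2l _ cUN); apply: leq_trans (leq_sub2r _ py).
  by rewrite /threshold mulnDl; lia.
have dUW : [disjoint U & W].
  rewrite disjoint_subset; apply/fintype.subsetP => z zU.
  by rewrite !inE; move: zU; rewrite inE => ->.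
have [u [w [uU wW uw]]] := edge_between dUW (eq_leq (esym cU)) cW.
have ux : big_colors u = big_colors x.
  by move: uU; rewrite inE => /sx; rewrite inE => /eqP.
move: wW; rewrite !inE negb_or => /andP[/andP[_ wN] /eqP wy].
have Ecomp := color_comp_eq uw erefl.
set i := c _ in Ecomp.
(* The ends of an edge share their component in its colour [i]. If it is big, both types contain
   [i]; if it is small, [w] lies in [N]. *)
have [iu|iu] := boolP (i \in big_colors u).
  by have := iu; rewrite inE Ecomp; move: iu; rewrite ux => /disj; rewrite -wy inE => /negP.
case/negP: wN; apply/bigcupP; exists u => //; apply/bigcupP; exists i => //.
by rewrite Ecomp inE connect0.
Qed.

(** There are at most [2 ^ r] types, and each unpopular one is attained by fewer than [threshold]
    vertices. *)
Lemma card_unpopular : (#|V| <= #|popular| + 2 ^ r * threshold)%N.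
Proof.
rewrite -(cardsC popular) leq_add2l -sum1_card.
rewrite (partition_big big_colors predT) //=.
apply: (@leq_trans (\sum_(A : {set 'I_r}) threshold)); last first.
  by rewrite sum_nat_const -cardsT -powersetT card_powerset cardsT card_ord.
apply: leq_sum => A _; rewrite sum1_card.
have [v /= /andP[]|none] := pickP (fun v => (v \in ~: popular) && (big_colors v == A))%SET.
  rewrite !inE -ltnNge => pv /eqP vA; apply: leq_trans (ltnW pv).
  apply/subset_leq_card/fintype.subsetP => w.
  by rewrite inE unfold_in => /andP[_ /eqP ->]; rewrite vA.
by rewrite (eq_card0 (A := [pred v | _ && _])).
Qed.

Hypothesis r_gt0 : (0 < r)%N.

(** Since popular types meet, the sets attached to the [r] colours cover all pairs of popular
    vertices; the largest of them gives [i]. *)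
Lemma phi_le_big_colors : exists i,
  (phi r #|popular| <= #|[set v | i \in big_colors v]%SET|)%N.
Proof.
pose f i := #|[set v | i \in big_colors v]%SET|.
have [i _ hi] := @arg_maxnP _ (Ordinal r_gt0) predT f isT.
exists i; apply: (phi_le r_gt0 (f := @enum_val V (mem popular))
  (A := fun i => [set v | i \in big_colors v]%SET)) => [|j|x y _].
- exact: enum_val_inj.
- exact: hi.
have [j [jx jy]] := popular_meet (enum_valP x) (enum_valP y).
by exists j; rewrite !inE in jx jy *.
Qed.

Lemma exists_spanning_tree : connected_graph G -> exists T i, spanning_tree G T /\
  (K * phi r #|popular| <= K * #|[set e in edges T | c e == i]%SET| + #|V|)%N.
Proof.
move=> [V0 cG]; have [i hi] := phi_le_big_colors.
(* [F] is a maximal forest in colour [i], grown from the empty graph; [T] then extends it within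
   [G]. *)
have [F [aF _ FH HF]] := acyclic_extend (@empty_graph_acyclic V)
  (fun x y (xy : empty_graph V x y) => (False_ind (color_graph i x y) (notF xy))).
have FG : subrel F G by move=> x y /FH /andP[].
have [T [aT FT TG GT]] := acyclic_extend aF FG.
exists T, i; split; first by split=> //; split=> //; split=> // x y; apply: GT.
apply: (@leq_trans (K * #|[set v | i \in big_colors v]%SET|)).
  by rewrite leq_mul2l hi orbT.
have -> : [set v | i \in big_colors v]%SET =
    [set v | (K < #|[set w | connect F v w]|)%N]%SET.
  apply/setP=> v; rewrite !inE; congr (_ < #|pred_of_set _|)%N; apply/setP=> w.
  rewrite !inE; apply/idP/idP; first exact: HF.
  by apply: connect_sub => {}v {}w /FH; exact: connect1.
apply: leq_trans (card_big_components F K) _.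
rewrite leq_add2r leq_mul2l; apply/orP; right; apply/subset_leq_card/fintype.subsetP => e.
rewrite !inE => /existsP[x /existsP[y /andP[Fxy /eqP->]]].
have /andP[_ ->] := FH _ _ Fxy; rewrite andbT.
by apply/existsP; exists x; apply/existsP; exists y; rewrite (FT _ _ Fxy) eqxx.
Qed.

End ComponentTypes.

Local Open Scope ring_scope.

(** * The limit of [phi r n / n] as an infimum *)

Section PhiLimit.
Variables (R : realType) (r : nat).
Hypothesis r_gt0 : (0 < r)%N.

(** At [n = 0] and [n = 1] the quotient is [0], which would spoil the infimum. *)
Let ratios : set R := [set x | exists2 n, (1 < n)%N & x = (phi r n)%:R / n%:R]%classic.

Let ratios_lb : lbound ratios 0.
Proof. by move=> x [n _ ->]; rewrite divr_ge0. Qed.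

Let ratios_has_inf : has_inf ratios.
Proof.
split; last by exists 0.
by exists ((phi r 2)%:R / 2%:R), 2%N.
Qed.

(** By blow-up, [phi r N / N] is at most [phi r n / n + phi r n / N], so one nearly optimal [n]
    controls all large [N]. In particular the limit exists. *)
Lemma phi_limE : phi_lim R r = inf ratios.
Proof.
apply/cvg_lim => //; apply/cvgrPdist_le => e e0.
have [x [n n1 ->] hn] := inf_adherent (divr_gt0 e0 (ltr0n R 2)) ratios_has_inf.
(* This makes [phi r n / N] at most [e / 2]; the [.+2] ensures [1 < N]. *)
exists (Num.bound ((phi r n)%:R / (e / 2%:R))).+2 => // N /= hN.
have N1 : (1 < N)%N by apply: leq_trans hN.
have N0 : 0 < N%:R :> R by rewrite ltr0n ltnW.
have n0 : 0 < n%:R :> R by rewrite ltr0n ltnW.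
have lbN : inf ratios <= (phi r N)%:R / N%:R.
  by apply: ge_inf; [exact: ratios_has_inf.2|exists N].
rewrite ler_distlC; apply/andP; split; first by rewrite lerBlDr (le_trans lbN) ?lerDl ?ltW.
have small : (phi r n)%:R / N%:R <= e / 2%:R.
  rewrite ler_pdivrMr // mulrC -ler_pdivrMr ?divr_gt0 //.
  apply: le_trans (ltW (archi_boundP _)) _; first by rewrite divr_ge0 // divr_ge0 // ltW.
  by rewrite ler_nat; apply: leq_trans hN; rewrite leqW.
have : (phi r N)%:R / N%:R <= (phi r n)%:R / n%:R + (phi r n)%:R / N%:R :> R.
  rewrite -mulrDr ler_pdivrMr // -mulrA mulrDl mulVf ?gt_eqF //.
  apply: le_trans (_ : ((N %/ n).+1 * phi r n)%:R <= _); first by rewrite ler_nat phi_blowup.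
  rewrite natrM mulrC ler_wpM2l // -natr1 lerD2r mulrC ler_pdivlMr // -natrM ler_nat.
  exact: leq_trunc_div.
lra.
Qed.

Lemma phi_lim_ge0 : 0 <= phi_lim R r.
Proof. by rewrite phi_limE; apply: lb_le_inf => //; have [] := ratios_has_inf. Qed.

Lemma phi_lim_le n : (1 < n)%N -> phi_lim R r * n%:R <= (phi r n)%:R.
Proof.
move=> n1; rewrite -ler_pdivlMr ?ltr0n 1?ltnW // phi_limE.
by apply: ge_inf; [exact: ratios_has_inf.2|exists n].
Qed.

Lemma phi_lim_le1 : phi_lim R r <= 1.
Proof.
have := phi_lim_le (isT : 1 < 2)%N.
have : (phi r 2)%:R <= 2%:R :> R by rewrite ler_nat phi_le_size.
lra.
Qed.

End PhiLimit.

(** * Choice of the constants and sum of the losses *)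

Theorem theorem1p10 (R : realType) (r : nat) (eps : R)
    (hr : (2 <= r)%N) (heps : 0 < eps) :
  exists beta : R, 0 < beta /\
    forall (V : finType) (G : sgraph V),
      connected_graph G -> beta_graph beta G ->
      forall c : {set V} -> 'I_r,
      exists (T : sgraph V) (i : 'I_r), spanning_tree G T /\
        (phi_lim R r - eps) * #|V|%:R
          <= #|[set e in edges T | c e == i]%SET|%:R.
Proof.
have r0 : (0 < r)%N by exact: ltnW.
(* The cap [1/2] yields [n >= 16] and at least [3n/4] popular vertices, hence [1 < m] for
   [phi_lim_le]. *)
pose e := Num.min eps 2^-1.
have e0 : 0 < e by rewrite lt_min heps invr_gt0 ltr0n.
have e1 : e <= 2^-1 by rewrite ge_min lexx orbT.
have eeps : e <= eps by rewrite ge_min lexx.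
(* With [K >= 2 / e], the loss of one vertex per big component is at most [e / 2 * n]. *)
pose K := (Num.bound (2 / e)).+1.
have K0 : 0 < K%:R :> R by rewrite ltr0n.
have hK : 2 <= e * K%:R.
  rewrite mulrC -ler_pdivrMr //; apply: le_trans (ltW (archi_boundP _)) _.
    by rewrite divr_ge0 // ltW.
  by rewrite ler_nat.
pose C : R := (2 ^ r * (r * K + 2))%:R.
have C1 : 2 <= C by rewrite /C (ler_nat _ 2) -[2%N]mul1n leq_mul // ?expn_gt0 // leq_addl.
(* At most [C * b] vertices are unpopular, and [b <= 2 * beta * n] turns this into [e / 2 * n]. *)
pose beta := e / (4 * C).
have C0 : 0 < C by lra.
have beta0 : 0 < beta by rewrite divr_gt0 // mulr_gt0.
have betaE : 4 * C * beta = e by rewrite /beta mulrC divfK // gt_eqF // mulr_gt0.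
exists beta; split=> // V G cG [sizeV hG] c.
have bV : 1 <= beta * #|V|%:R by rewrite mulrC -ler_pdivrMr // div1r.
(* Rounding up costs at most a factor [2], because [beta * n >= 1]. *)
pose b := (Num.trunc (beta * #|V|%:R)).+1.
have b_ge : beta * #|V|%:R <= b%:R by apply/ltW/truncnS_gt.
have b_le : b%:R <= 2 * (beta * #|V|%:R).
  have : (Num.trunc (beta * #|V|%:R))%:R <= beta * #|V|%:R.
    by rewrite truncn_le; apply: le_trans bV.
  rewrite /b -natr1; lra.
have hGb (U W : {set V}) : [disjoint U & W] -> (b <= #|U|)%N -> (b <= #|W|)%N ->
    exists u w, [/\ u \in U, w \in W & G u w].
  by move=> dUW bU bW; apply: hG => //; apply: le_trans b_ge _; rewrite ler_nat.
have [T [i [sT hT]]] := exists_spanning_tree c K hGb r0 cG.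
exists T, i; split=> //.
have := card_unpopular G c K b.
move: hT; set m := #|popular _ _ _ _|; set E := #|finset _|; set n := #|V|.
rewrite -/n in bV b_le b_ge *.
rewrite -(ler_nat R) natrD !natrM => hT.
rewrite -(ler_nat R) natrD /threshold mulnA natrM -/C => hm.
have n0 : 0 <= n%:R :> R by [].
have n16 : 16 <= n%:R :> R by nra.
have hCb : C * b%:R <= e / 2 * n%:R by nra.
have m2 : (1 < m)%N by rewrite -(ltr_nat R); nra.
have hphi := phi_lim_le R r0 m2.
have p0 := phi_lim_ge0 R r0; have p1 := phi_lim_le1 R r0.
move: (phi_lim R r) hphi p0 p1 => p hphi p0 p1.
(* Unpopular vertices cost [p * (e / 2 * n)] and roots [e / 2 * n]; as [p <= 1], the total is at
   most [e * n]. *)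
have h1 : p * (n%:R - e / 2 * n%:R) <= (phi r m)%:R.
  by apply: le_trans hphi; rewrite ler_wpM2l //; lra.
have h2 : (phi r m)%:R - E%:R <= e / 2 * n%:R.
  rewrite -(ler_pM2l K0); nra.
have h3 : p * (e * n%:R) <= e * n%:R by rewrite ler_piMl // mulr_ge0 // ltW.
have h4 : e * n%:R <= eps * n%:R by rewrite ler_wpM2r.
lra.
Qed.
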